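(* Let $\mathbb F\in\{\mathbb R,\mathbb C\}$, $d\ge 1$, and let $P(\lambda)=\sum_{i=0}^d\lambda^iA_i\in\mathbb F^{n,n}[\lambda]$ with $A_i^*=A_i\ge 0$ for $i=0,\dots,d$, where it is assumed that $A_0$ is invertible if $d$ is even. Then the index of $P(\lambda)$ is at most $d$.
   Context: $M^*$ denotes the conjugate transpose, $M\ge 0$ means Hermitian positive semidefinite. $P(\lambda)$ is regarded as a matrix polynomial of grade $d$ (the leading coefficient $A_d$ may be singular or zero, and $P$ may be singular). Its index is the index of a strong linearization of $P(\lambda)$, where the index of a pencil $\lambda E-A$ is the largest size $\sigma$ of a block $\lambda\mathcal J_\sigma(0)-I_\sigma$ (nilpotent Jordan block $\mathcal J_\sigma(0)$, belonging to the eigenvalue $\infty$) in its Kronecker canonical form, and $0$ if there are no such blocks. Equivalently, it is the largest partial multiplicity of the eigenvalue $0$ of the reversal $\mu^dP(1/\mu)=\sum_{i=0}^d\mu^{d-i}A_i$, i.e. the largest exponent of $\mu$ dividing a nonzero invariant polynomial in the Smith form of the reversal. *)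

(* Defs.v *)
From HB Require Import structures.
From mathcomp Require Import all_boot all_order all_algebra.
From mathcomp Require Import reals.
From mathcomp Require Export complex.

Set Implicit Arguments.
Unset Strict Implicit.
Unset Printing Implicit Defensive.

Import Order.TTheory GRing.Theory Num.Theory.
Local Open Scope ring_scope.

(* The two ground fields: R : realType is the field of real numbers and R[i]
   the field of complex numbers. *)
Variant ground_field := RealNumbers | ComplexNumbers.

Definition scalars (R : realType) (k : ground_field) : numFieldType :=
  match k with RealNumbers => R | ComplexNumbers => R[i] end.

Definition conj_scalar (R : realType) (k : ground_field) :
    scalars R k -> scalars R k :=
  match k with
  | RealNumbers => fun x => x
  | ComplexNumbers => fun z : R[i] => z^*
  end.

Definition to_complex (R : realType) (k : ground_field) :
    scalars R k -> R[i] :=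
  match k with
  | RealNumbers => fun x => (x%:C)%C
  | ComplexNumbers => fun z => z
  end.

Section ConjugateTranspose.
Variables (R : realType) (k : ground_field).
Local Notation F := (scalars R k).

Definition ctrmx m n (M : 'M[F]_(m, n)) : 'M[F]_(n, m) :=
  map_mx (@conj_scalar R k) M^T.

Definition hermitian_psd n (M : 'M[F]_n) : Prop :=
  ctrmx M = M /\ forall x : 'cV[F]_n, 0 <= (ctrmx x *m M *m x) ord0 ord0.

End ConjugateTranspose.

Section MatrixPolynomials.
Variable F : fieldType.

Local Notation constmx M := (map_mx (@polyC F) M).

(* A matrix polynomial of grade d is given by its coefficients
   A : 'I_d.+1 -> 'M[F]_n; the leading ones are allowed to vanish. *)
Definition matpoly n d (A : 'I_d.+1 -> 'M[F]_n) : 'M[{poly F}]_n :=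
  \sum_(i < d.+1) 'X^i *: constmx (A i).

Definition matpoly_rev n d (A : 'I_d.+1 -> 'M[F]_n) : 'M[{poly F}]_n :=
  \sum_(i < d.+1) 'X^(d - i) *: constmx (A i).

(* The pencil 'X * E - A and its reversal as a polynomial of grade 1. *)
Definition pencil m n (E A : 'M[F]_(m, n)) : 'M[{poly F}]_(m, n) :=
  'X *: constmx E - constmx A.

Definition pencil_rev m n (E A : 'M[F]_(m, n)) : 'M[{poly F}]_(m, n) :=
  constmx E - 'X *: constmx A.

(* Over {poly F}, unitmx is the set of unimodular matrices. *)
Definition unimodular_equiv n (M N : 'M[{poly F}]_n) : Prop :=
  exists U V : 'M[{poly F}]_n,
    [/\ U \in unitmx, V \in unitmx & U *m M *m V = N].

(* For d > 0 the size n + d.-1 * n is d * n. *)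
Definition strong_linearization n d (A : 'I_d.+1 -> 'M[F]_n)
    (L1 L0 : 'M[F]_(n + d.-1 * n)) : Prop :=
  unimodular_equiv (pencil L1 L0) (block_mx (matpoly A) 0 0 1%:M) /\
  unimodular_equiv (pencil_rev L1 L0) (block_mx (matpoly_rev A) 0 0 1%:M).

Definition jordan_block r (a : F) : 'M[F]_r :=
  \matrix_(i, j) (a *+ (j == i) + (j == i.+1 :> nat)%:R).

Variant kronecker_block :=
  | KRight of nat        (* size e x e.+1, e >= 0 *)
  | KLeft of nat         (* size e.+1 x e, e >= 0 *)
  | KFinite of nat & F   (* finite eigenvalue *)
  | KInfinite of nat.    (* eigenvalue infinity *)

Definition kblock_rows (b : kronecker_block) : nat :=
  match b with
  | KRight e => e | KLeft e => e.+1 | KFinite r _ => r | KInfinite s => s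
  end.

Definition kblock_cols (b : kronecker_block) : nat :=
  match b with
  | KRight e => e.+1 | KLeft e => e | KFinite r _ => r | KInfinite s => s
  end.

Definition kright_mx e : 'M[{poly F}]_(e, e.+1) :=
  \matrix_(i, j) ('X *+ (j == i :> nat) - (j == i.+1 :> nat)%:R).

Definition kblock_mx (b : kronecker_block) :
    'M[{poly F}]_(kblock_rows b, kblock_cols b) :=
  match b with
  | KRight e => kright_mx e
  | KLeft e => (kright_mx e)^T
  | KFinite r a => pencil 1%:M (jordan_block r a)
  | KInfinite s => pencil (jordan_block s 0) 1%:M
  end.

Definition kblock_proper (b : kronecker_block) : bool :=
  match b with
  | KFinite r _ => (0 < r)%N
  | KInfinite s => (0 < s)%N
  | _ => true
  end.

Definition kform_rows (bs : seq kronecker_block) : nat :=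
  sumn (map kblock_rows bs).

Definition kform_cols (bs : seq kronecker_block) : nat :=
  sumn (map kblock_cols bs).

Fixpoint kform_mx (bs : seq kronecker_block) :
    'M[{poly F}]_(kform_rows bs, kform_cols bs) :=
  match bs with
  | [::] => 0
  | b :: bs' => block_mx (kblock_mx b) 0 0 (kform_mx bs')
  end.

(* The pencil 'X * E - A is strictly equivalent to the block diagonal pencil
   with diagonal blocks bs. The eigenvalues of the finite blocks lie in F, so
   that this is the Kronecker canonical form when F is algebraically closed. *)
Definition kronecker_form m n (E A : 'M[F]_(m, n))
    (bs : seq kronecker_block) : Prop :=
  all kblock_proper bs /\
  exists (er : kform_rows bs = m) (ec : kform_cols bs = n)
         (S : 'M[F]_m) (T : 'M[F]_n),
    [/\ S \in unitmx, T \in unitmx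
      & constmx S *m pencil E A *m constmx T = castmx (er, ec) (kform_mx bs)].

Definition infinite_size (b : kronecker_block) : nat :=
  if b is KInfinite s then s else 0.

Definition is_pencil_index m n (E A : 'M[F]_(m, n)) (nu : nat) : Prop :=
  exists2 bs, kronecker_form E A bs & nu = (\max_(b <- bs) infinite_size b)%N.

Definition is_index n d (A : 'I_d.+1 -> 'M[F]_n) (nu : nat) : Prop :=
  exists L1 L0, strong_linearization A L1 L0 /\ is_pencil_index L1 L0 nu.

End MatrixPolynomials.

(* The Kronecker canonical form is taken over the complex numbers, also for
   real coefficients. *)
Definition has_index (R : realType) (k : ground_field) n d
    (A : 'I_d.+1 -> 'M[scalars R k]_n) (nu : nat) : Prop :=
  is_index (fun i => map_mx (@to_complex R k) (A i)) nu.

(* Main.v *)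
Require Import Defs.
From mathcomp Require Import all_boot all_order all_algebra reals ring.

Set Implicit Arguments.
Unset Strict Implicit.
Unset Printing Implicit Defensive.

Import Order.TTheory GRing.Theory Num.Theory.
Local Open Scope ring_scope.
Local Open Scope sesquilinear_scope.

(** Write Q for the reversal of P and X for its variable; index at most d means
    that no partial multiplicity of Q at 0 exceeds d. Two ideas carry the proof.

    A spectral condition that needs no Smith form. For a matrix polynomial M,
    possibly singular or rectangular, all partial multiplicities at 0 are less
    than N exactly when every vector polynomial x with M x divisible by X^N
    agrees at 0 with some polynomial kernel vector of M ([kernel_lifts]): look
    at a diagonal local Smith form. The condition is inherited by unimodularly
    equivalent matrices ([kernel_lifts_equiv]) and by diagonal blocks, so it
    passes from Q to the reversed pencil of a strong linearization and on to
    each block at infinity of its Kronecker form. A reversed block of size s has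
    trivial kernel, yet sends (1, X, ..., X^(s-1)) to a multiple of X^s; hence
    s < N ([kernel_lifts_infinite_block]).

    Positivity of every coefficient. Let Q x be divisible by X^(d+1). For real
    t > 0,
      sum_i t^(d-i) x(t)^* A_i x(t) = x(t)^* Q(t) x(t) = O(t^(d+1)),
    and no summand is negative, so each of them is O(t^(d+1)) on its own and
    x(t)^* A_i x(t) = O(t^(i+1)) tends to 0 with t. Thus x(0)^* A_i x(0) = 0,
    and then A_i x(0) = 0 by semidefiniteness ([psd_mul0]). The constant vector
    x(0) is therefore an exact kernel vector of Q that agrees with x at 0, which
    is the condition with N = d + 1 ([kernel_lifts_psd_rev]). Real symmetric
    coefficients remain positive semidefinite over the complex numbers
    ([psd_complexify]). *)

(** * Partial multiplicities at 0 through kernel vectors *)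

Section KernelLifting.
Variable F : fieldType.
Implicit Types (m n N : nat).

(** All partial multiplicities of [M] at 0 are less than [N]. For singular [M]
    the constant term of [x] may be nonzero, but only by way of the kernel. *)
Definition kernel_lifts N m n (M : 'M[{poly F}]_(m, n)) : Prop :=
  forall (x : 'cV_n) (z : 'cV_m), M *m x = 'X^N *: z ->
  exists y w : 'cV_n, M *m y = 0 /\ x = y + 'X *: w.

(** Kernel vectors and approximate kernel vectors are both transported by the
    substitution [x := V x], whose inverse is again polynomial. *)
Lemma kernel_lifts_equiv N m n (U : 'M_m) (V : 'M_n)
    (M : 'M[{poly F}]_(m, n)) :
    U \in unitmx -> V \in unitmx ->
  kernel_lifts N (U *m M *m V) <-> kernel_lifts N M.
Proof.
have half m' n' (U' : 'M_m') (V' : 'M_n') (M' : 'M[{poly F}]_(m', n')) :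
    U' \in unitmx -> V' \in unitmx ->
  kernel_lifts N M' -> kernel_lifts N (U' *m M' *m V').
  move=> U'u V'u lift x z Ex.
  have [|y [w [My Vx]]] := lift (V' *m x) (invmx U' *m z).
    by rewrite scalemxAr -Ex !mulmxA mulVmx // mul1mx.
  exists (invmx V' *m y), (invmx V' *m w); split.
    by rewrite -!mulmxA mulKVmx // My mulmx0.
  by rewrite scalemxAr -mulmxDr -Vx mulKmx.
move=> Uu Vu; split; last exact: half.
move/(@half _ _ (invmx U) (invmx V)); rewrite !unitmx_inv => /(_ Uu Vu).
by rewrite !mulmxA mulVmx // mul1mx mulmxK.
Qed.

Lemma kernel_lifts_block_ul N m1 n1 m2 n2
    (M1 : 'M[{poly F}]_(m1, n1)) (M2 : 'M_(m2, n2)) :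
  kernel_lifts N (block_mx M1 0 0 M2) -> kernel_lifts N M1.
Proof.
move=> lift x z Ex; have [|y [w [My Exy]]] := lift (col_mx x 0) (col_mx z 0).
  by rewrite mul_block_col !mulmx0 mul0mx !addr0 Ex scale_col_mx scaler0.
move: My Exy; rewrite -[y]vsubmxK -[w]vsubmxK mul_block_col !mul0mx addr0.
rewrite -[0 in RHS]vsubmxK => /eq_col_mx[My _].
rewrite scale_col_mx add_col_mx => /eq_col_mx[-> _].
by exists (usubmx y), (usubmx w); rewrite My linear0.
Qed.

Lemma kernel_lifts_block_dr N m1 n1 m2 n2
    (M1 : 'M[{poly F}]_(m1, n1)) (M2 : 'M_(m2, n2)) :
  kernel_lifts N (block_mx M1 0 0 M2) -> kernel_lifts N M2.
Proof.
move=> lift x z Ex; have [|y [w [My Exy]]] := lift (col_mx 0 x) (col_mx 0 z).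
  by rewrite mul_block_col !mulmx0 mul0mx !add0r Ex scale_col_mx scaler0.
move: My Exy; rewrite -[y]vsubmxK -[w]vsubmxK mul_block_col !mul0mx add0r.
rewrite -[0 in RHS]vsubmxK => /eq_col_mx[_ My].
rewrite scale_col_mx add_col_mx => /eq_col_mx[_ ->].
by exists (dsubmx y), (dsubmx w); rewrite My linear0.
Qed.

(** The second component of an approximate kernel vector is itself divisible by
    ['X^N.+1], hence vanishes at 0; this is where a positive exponent counts. *)
Lemma kernel_lifts_block1 N m n p (M : 'M[{poly F}]_(m, n)) :
  kernel_lifts N.+1 M -> kernel_lifts N.+1 (block_mx M 0 0 (1%:M : 'M_p)).
Proof.
move=> lift x z; rewrite -[x]vsubmxK -[z]vsubmxK mul_block_col !mul0mx.
rewrite mul1mx addr0 add0r scale_col_mx => /eq_col_mx[/lift[y [w [My ->]]] ->].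
exists (col_mx y 0), (col_mx w ('X^N *: dsubmx z)); split.
  by rewrite mul_block_col My !mulmx0 mul0mx !addr0 col_mx0.
by rewrite scale_col_mx add_col_mx add0r scalerA -exprS.
Qed.

Lemma kernel_lifts_castmx N m n m' n' (eqs : (m = m') * (n = n'))
    (M : 'M[{poly F}]_(m, n)) :
  kernel_lifts N (castmx eqs M) -> kernel_lifts N M.
Proof. by case: eqs => em en; case: _ / em; case: _ / en; rewrite castmx_id. Qed.

(** * Reversed Kronecker blocks at infinity *)

Local Notation constmx M := (map_mx (@polyC F) M).

(** A Kronecker form is given by the entries of a polynomial matrix and not by a
    pair of coefficient matrices; reversing entrywise applies to both. *)
Definition grade1_rev (p : {poly F}) : {poly F} := (p`_1)%:P + 'X * (p`_0)%:P.

Lemma grade1_revD : {morph grade1_rev : p q / p + q}.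
Proof. by move=> p q; rewrite /grade1_rev !coefD !polyCD mulrDr addrACA. Qed.

Lemma grade1_rev0 : grade1_rev 0 = 0.
Proof. by rewrite /grade1_rev !coef0 !polyC0 mulr0 addr0. Qed.

Lemma grade1_revCM c p : grade1_rev (c%:P * p) = c%:P * grade1_rev p.
Proof. by rewrite /grade1_rev !coefCM !polyCM mulrDr mulrCA. Qed.

(** Strict equivalence of pencils gives strict equivalence of their reversals. *)
Lemma map_grade1_rev_mul m n (S : 'M_m) (T : 'M_n) (M : 'M_(m, n)) :
  map_mx grade1_rev (constmx S *m M *m constmx T)
    = constmx S *m map_mx grade1_rev M *m constmx T.
Proof.
apply/matrixP=> i j; rewrite !mxE (big_morph _ grade1_revD grade1_rev0).
apply: eq_bigr => k _; rewrite !mxE mulrC grade1_revCM mulrC; congr (_ * _).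
rewrite (big_morph _ grade1_revD grade1_rev0).
by apply: eq_bigr => l _; rewrite !mxE grade1_revCM.
Qed.

Lemma map_grade1_rev_pencil m n (E A : 'M_(m, n)) :
  map_mx grade1_rev (pencil E A) = pencil_rev E A.
Proof.
apply/matrixP=> i j; rewrite !mxE /grade1_rev !coefB !coefXM !coefC /=.
by rewrite subr0 sub0r polyCN mulrN.
Qed.

(** The vector [(1, 'X, ..., 'X^(s-1))] encodes the Jordan chain of length [s]:
    the block maps it to [(0, ..., 0, - 'X^s)], and the kernel is trivial. *)
Lemma kernel_lifts_infinite_block N s : (0 < s)%N ->
  kernel_lifts N (pencil_rev (@jordan_block F s 0) 1%:M) -> (s < N)%N.
Proof.
case: s => // s _ lift; rewrite ltnNge; apply/negP=> leNs.
have row_eq (y : 'cV[{poly F}]_s.+1) (i : 'I_s.+1) :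
  (pencil_rev (jordan_block s.+1 0) 1%:M *m y) i 0
    = (if (i < s)%N then y (inord i.+1) 0 else 0) - 'X * y i 0.
  rewrite mulmxBl -scalemxAl map_mx1 mul1mx !mxE; congr (_ - _).
  have entry j : map_mx polyC (jordan_block s.+1 0) i j * y j 0
                   = if j == i.+1 :> nat then y j 0 else 0 :> {poly F}.
    by rewrite !mxE mul0rn add0r; case: eqP; rewrite ?mul1r ?mul0r.
  rewrite (eq_bigr _ (fun j _ => entry j)) -big_mkcond /=; case: ifP => lt_is.
    rewrite (big_pred1 (inord i.+1)) // => j /=.
    by rewrite -(inj_eq val_inj) /= inordK // ltnS.
  rewrite big_pred0 // => j; apply: contraFF lt_is => /eqP ji.
  by rewrite -ltnS -ji.
have [|y [w [My Exy]]] := lift (\col_i 'X^i)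
    (\col_i (if (i < s)%N then 0 else - 'X^(s.+1 - N))).
  apply/colP=> i; rewrite row_eq !mxE -exprS; case: ltnP => [lt_is|le_si].
    by rewrite inordK ?ltnS // subrr mulr0.
  have -> : i = s :> nat by apply/eqP; rewrite eqn_leq le_si -ltnS ltn_ord.
  by rewrite sub0r mulrN -exprD subnKC.
have My0 i : (pencil_rev (jordan_block s.+1 0) 1%:M *m y) i 0 = 0.
  by rewrite My mxE.
have y0 i : y i 0 = 0.
  have yrec k : (k <= s)%N -> y (inord (s - k)) 0 = 0.
    elim: k => [|k IHk] le_ks.
      have /eqP := My0 ord_max.
      rewrite row_eq /= ltnn sub0r oppr_eq0 mulf_eq0 polyX_eq0 /= => /eqP.
      by rewrite subn0; congr (y _ _ = _); apply/val_inj; rewrite /= inordK.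
    have /eqP := My0 (inord (s - k.+1)).
    rewrite row_eq inordK ?ltnS ?leq_subr // ltn_subrL /= (leq_trans _ le_ks) //.
    rewrite subnSK // IHk ?(ltnW le_ks) // sub0r oppr_eq0 mulf_eq0 polyX_eq0 /=.
    by move/eqP.
  have := yrec (s - i)%N (leq_subr _ _).
  by rewrite subKn ?inord_val // -ltnS.
have /(congr1 (fun p => p.[0])) := congr1 (fun M : 'cV_s.+1 => M 0 0) Exy.
rewrite !mxE y0 add0r expr0 hornerM hornerX mul0r hornerC => /eqP.
by rewrite oner_eq0.
Qed.

Lemma kernel_lifts_kform N bs : all (@kblock_proper F) bs ->
  kernel_lifts N.+1 (map_mx grade1_rev (kform_mx bs)) ->
  (\max_(b <- bs) infinite_size b <= N)%N.
Proof.
elim: bs => [|b bs IHbs]; first by rewrite big_nil.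
rewrite [kform_mx _]/= big_cons => /andP[b_ok bs_ok].
have map0 m n : map_mx grade1_rev 0 = 0 :> 'M_(m, n).
  by apply/matrixP=> i j; rewrite !mxE grade1_rev0.
rewrite (map_block_mx grade1_rev) !map0 => lift.
rewrite geq_max (IHbs bs_ok (kernel_lifts_block_dr lift)) andbT.
case: b b_ok {IHbs bs_ok} lift => //= s s_gt0 /kernel_lifts_block_ul.
by rewrite map_grade1_rev_pencil => /(kernel_lifts_infinite_block s_gt0).
Qed.

Lemma pencil_index_le N m n (E A : 'M[F]_(m, n)) nu :
  kernel_lifts N.+1 (pencil_rev E A) -> is_pencil_index E A nu -> (nu <= N)%N.
Proof.
move=> lift [bs [bs_ok [er [ec [S [T [Su Tu Ebs]]]]]] ->].
apply: kernel_lifts_kform => //.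
apply: (kernel_lifts_castmx (eqs := (er, ec))).
rewrite -map_castmx -Ebs map_grade1_rev_mul map_grade1_rev_pencil.
by apply/kernel_lifts_equiv => //; rewrite map_unitmx.
Qed.

Lemma index_le N n d (A : 'I_d.+1 -> 'M[F]_n) nu :
  kernel_lifts N.+1 (matpoly_rev A) -> is_index A nu -> (nu <= N)%N.
Proof.
move=> lift [L1 [L0 [[_ [U [V [Uu Vu ELr]]]]]]].
apply: pencil_index_le; apply/(kernel_lifts_equiv _ _ Uu Vu).
by rewrite ELr; apply: kernel_lifts_block1.
Qed.

End KernelLifting.

(** * Positive semidefinite coefficients *)

Section Positivity.
Variable C : numClosedFieldType.

Definition psd n (B : 'M[C]_n) : Prop :=
  B ^t* = B /\ forall y : 'cV_n, 0 <= (y ^t* *m B *m y) 0 0.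

(** If [x] were isotropic with [y = B x] nonzero, the form would take the value
    [2 t |y|^2 + O(t^2)] at [x + t y], negative for small [t < 0]. *)
Lemma psd_mul0 n (B : 'M[C]_n) (x : 'cV_n) :
  psd B -> (x ^t* *m B *m x) 0 0 = 0 -> B *m x = 0.
Proof.
move=> [B_herm B_psd] xBx; set y := B *m x.
pose s := (y ^t* *m y) 0 0; pose q := (y ^t* *m B *m y) 0 0.
have s_sum : s = \sum_i `|y i 0| ^+ 2.
  by rewrite /s mxE; apply: eq_bigr => i _; rewrite !mxE normCK mulrC.
have s_ge0 : 0 <= s by rewrite s_sum sumr_ge0 // => i _; rewrite exprn_ge0.
have q_ge0 : 0 <= q by apply: B_psd.
have expand t : t \is Num.real -> 0 <= t * s *+ 2 + t ^+ 2 * q.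
  move=> t_real; have := B_psd (x + t *: y).
  have -> : (x + t *: y) ^t* = x ^t* + t *: y ^t*.
    by apply/matrixP=> i j; rewrite !mxE rmorphD rmorphM /= (conj_Creal t_real).
  have xtB : x ^t* *m B = y ^t*.
    by rewrite /y trmx_mul map_mxM B_herm.
  have mxD (M N : 'M[C]_1) : (M + N) 0 0 = M 0 0 + N 0 0 by rewrite mxE.
  have mxZ (a : C) (M : 'M[C]_1) : (a *: M) 0 0 = a * M 0 0 by rewrite mxE.
  rewrite !mulmxDl !mulmxDr -!scalemxAl -!scalemxAr scalerA !mxD xBx add0r.
  by rewrite !mxZ xtB -[y ^t* *m B *m x]mulmxA -/y -/s -/q -expr2 addrA -mulr2n.
have q1_gt0 : 0 < q + 1 by rewrite ltr_wpDl.
(* Take t = - s / (q + 1): the minimum of 2 t s + t^2 q is at - s / q, and q + 1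
   in place of q keeps the quotient defined when q = 0. *)
have s0 : s = 0.
  have t_real : - (s / (q + 1)) \is Num.real.
    by rewrite realN ger0_real // divr_ge0 // ltW.
  have := expand _ t_real.
  have -> : - (s / (q + 1)) * s *+ 2 + (- (s / (q + 1))) ^+ 2 * q
              = - ((s / (q + 1)) ^+ 2 * (q + 2%:R)).
    by field; rewrite gt_eqF.
  rewrite oppr_ge0 pmulr_lle0 ?ltr_wpDl // => sq_le0.
  have /eqP : (s / (q + 1)) ^+ 2 = 0.
    by apply/eqP; rewrite eq_le sq_le0 exprn_ge0 // divr_ge0 // ltW.
  by rewrite sqrf_eq0 mulf_eq0 invr_eq0 (gt_eqF q1_gt0) orbF => /eqP.
apply/colP=> i; rewrite [RHS]mxE.
have /eqP : \sum_i `|y i 0| ^+ 2 = 0 by rewrite -s_sum.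
rewrite psumr_eq0 => [/allP /(_ i (mem_index_enum _))|j _]; last exact: exprn_ge0.
by rewrite /= sqrf_eq0 normr_eq0 => /eqP.
Qed.

(** Letting [t] tend to 0 gives [p.[0] <= 0]; instead of a limit, [p - p.[0]] is
    written as a multiple of ['X] and polynomials are bounded on the unit disk. *)
Lemma horner0_eq0 (p q : {poly C}) : 0 <= p.[0] ->
    (forall t, 0 < t -> p.[t] <= t * q.[t]) ->
  p.[0] = 0.
Proof.
move=> p0_ge0 le_pq; apply/eqP; apply: contraT => p0_neq0.
have c_gt0 : 0 < p.[0] by rewrite lt_def p0_neq0.
have /factor_theorem[h Eh] : root (p - (p.[0])%:P) 0.
  by rewrite /root hornerD hornerN hornerC subrr.
have [M leM] := poly_disk_bound (q - h) 1.
have M_ge0 : 0 <= M by apply: le_trans (leM 0 _); rewrite ?normr0 ?ler01.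
pose t := p.[0] / (p.[0] + M + 1).
have D_gt0 : 0 < p.[0] + M + 1 by rewrite addr_gt0 // ltr_wpDr.
have t_gt0 : 0 < t by rewrite divr_gt0.
have t_le1 : `|t| <= 1.
  by rewrite gtr0_norm // ler_pdivrMr // mul1r -addrA lerDl addr_ge0.
have : p.[0] <= t * (q - h).[t].
  have Et : h.[t] * t = p.[t] - p.[0].
    have := congr1 (horner^~ t) Eh; rewrite /= hornerD hornerN hornerC => ->.
    by rewrite hornerM hornerXsubC subr0.
  by rewrite hornerD hornerN mulrBr lerBrDr [t * h.[t]]mulrC Et addrC subrK le_pq.
move=> le_c; have : p.[0] <= t * M.
  apply: (le_trans le_c); rewrite ler_pM2l //.
  have g_gt0 : 0 < (q - h).[t] by rewrite -(pmulr_rgt0 _ t_gt0) (lt_le_trans c_gt0 le_c).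
  by rewrite -[leLHS]gtr0_norm // leM.
rewrite /t mulrAC ler_pdivlMr // ler_pM2l // [p.[0] + M]addrC -addrA gerDl.
by rewrite lt_geF ?addr_gt0.
Qed.

(** The nonnegative terms of [x^* Q x] cannot cancel, so each of them inherits
    the vanishing order of the sum, and [x.[0]] is killed by all coefficients. *)
Lemma kernel_lifts_psd_rev n d (A : 'I_d.+1 -> 'M[C]_n) :
  (forall i, psd (A i)) -> kernel_lifts d.+1 (matpoly_rev A).
Proof.
move=> A_psd x z Ex.
(* Conjugating only the coefficients keeps [xs] polynomial; it agrees with the
   pointwise conjugate transpose of [x] at real arguments. *)
pose xs : 'rV[{poly C}]_n := map_mx (map_poly Num.conj) x^T.
pose p i := (xs *m map_mx polyC (A i) *m x) 0 0.
have evxs t : t \is Num.real ->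
    map_mx (horner_eval t) xs = (map_mx (horner_eval t) x) ^t*.
  move=> t_real; apply/matrixP=> i j; rewrite !mxE /horner_eval.
  by rewrite -[t in LHS]conj_Creal // horner_map.
have p_ev i t : t \is Num.real ->
    (p i).[t] = ((map_mx (horner_eval t) x) ^t* *m A i *m map_mx (horner_eval t) x) 0 0.
  move=> t_real; rewrite -evxs //.
  have {1}<- : map_mx (horner_eval t) (map_mx polyC (A i)) = A i.
    by apply/matrixP=> a b; rewrite !mxE /horner_eval hornerC.
  by rewrite -!map_mxM mxE.
have p_ge0 i t : t \is Num.real -> 0 <= (p i).[t].
  by move=> t_real; rewrite p_ev //; case: (A_psd i).
pose s := (xs *m z) 0 0.
have sum_p : \sum_(i < d.+1) 'X^(d - i) * p i = 'X^(d.+1) * s.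
  have /(congr1 (fun M : 'M_1 => M 0 0)) := congr1 (mulmx xs) Ex.
  rewrite -scalemxAr [RHS]mxE -/s => <-.
  rewrite /matpoly_rev mulmx_suml mulmx_sumr summxE; apply: eq_bigr => i _.
  by rewrite -scalemxAl -scalemxAr mxE mulmxA.
have p0 i : (p i).[0] = 0.
  apply: (horner0_eq0 (q := 'X^i * s)) => [|t t_gt0].
    by rewrite p_ge0 // rpred0.
  have t_real : t \is Num.real by rewrite gtr0_real.
  have sum_pt : \sum_(j < d.+1) t ^+ (d - j) * (p j).[t] = t ^+ d.+1 * s.[t].
    have := congr1 (horner^~ t) sum_p; rewrite /= horner_sum hornerM hornerXn.
    by move=> <-; apply: eq_bigr => j _; rewrite hornerM hornerXn.
  have td_gt0 : 0 < t ^+ (d - i) by rewrite exprn_gt0.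
  rewrite -(ler_pM2l td_gt0) hornerM hornerXn !mulrA -exprSr -exprD.
  rewrite addSn subnK ?leq_ord // -sum_pt (bigD1 i) //= lerDl sumr_ge0 // => j _.
  by rewrite mulr_ge0 ?p_ge0 // exprn_ge0 // ltW.
pose x0 := map_mx (horner_eval 0) x.
have Ax0 i : A i *m x0 = 0.
  by apply: (psd_mul0 (A_psd i)); rewrite -p_ev ?p0 // rpred0.
exists (map_mx polyC x0), (map_mx (drop_poly 1) x); split.
  rewrite mulmx_suml big1 // => i _.
  by rewrite -scalemxAl -map_mxM Ax0 map_mx0 scaler0.
apply/colP=> i; rewrite !mxE /horner_eval horner_coef0.
apply/polyP=> k; rewrite coefD coefC coefXM coef_drop_poly.
by case: k => [|k]; rewrite ?addr0 ?add0r ?addn1.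
Qed.

End Positivity.

(** * From real to complex coefficients *)

Section Complexification.
Variable R : realType.

(** In the real case, [y = u + i v] gives [y^* A y = u^T A u + v^T A v], the
    mixed terms cancelling by symmetry. *)
Lemma psd_complexify (k : ground_field) n (A : 'M[scalars R k]_n) :
  hermitian_psd A -> psd (map_mx (@to_complex R k) A).
Proof.
case: k A => A [A_herm A_ge0] /=; last first.
  have -> : map_mx (@to_complex R ComplexNumbers) A = A.
    by apply/matrixP=> i j; rewrite mxE.
  by split.
have A_sym : A^T = A by rewrite -[RHS]A_herm; apply/matrixP=> i j; rewrite !mxE.
pose f := real_complex R.
have A_ge0' (u : 'cV[R]_n) : 0 <= (u^T *m A *m u) 0 0.
  have := A_ge0 u; congr (0 <= (_ *m _ *m _) _ _).
  by apply/matrixP=> i j; rewrite !mxE.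
split; first by apply/matrixP=> i j; rewrite !mxE /= -[in RHS]A_sym mxE; exact: conjc_real.
move=> y; pose u := map_mx (@complex.Re R) y; pose v := map_mx (@complex.Im R) y.
have -> : y ^t* = map_mx f u^T - 'i%C *: map_mx f v^T.
  apply/matrixP=> i j; rewrite !mxE; case: (y j i) => a b /=.
  by rewrite -[LHS]/(conjc (a +i* b)%C) /f; simpc.
have Ey : y = map_mx f u + 'i%C *: map_mx f v.
  by apply/matrixP=> i j; rewrite !mxE -complexE.
have uAv : v^T *m A *m u = u^T *m A *m v.
  have tr1 (M : 'M[R]_1) : M^T = M.
    by apply/matrixP=> i j; rewrite mxE !ord1.
  by rewrite -[LHS]tr1 !trmx_mul A_sym trmxK mulmxA.
have -> : (map_mx f u^T - 'i%C *: map_mx f v^T) *m map_mx f A *m y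
    = map_mx f (u^T *m A *m u + v^T *m A *m v).
  rewrite Ey !mulmxBl !mulmxDr -!scalemxAl -!scalemxAr -!map_mxM uAv.
  rewrite scalerA -expr2 sqr_i scaleN1r.
  by rewrite opprD opprK addrA -[_ + _ - _]addrA subrr addr0 map_mxD.
by rewrite mxE ler0c mxE addr_ge0.
Qed.

End Complexification.

Theorem theorem6p5 (R : realType) (k : ground_field) (n d : nat)
    (A : 'I_d.+1 -> 'M[scalars R k]_n)
    (d_gt0 : (0 < d)%N)
    (A_psd : forall i, hermitian_psd (A i))
    (A0_unit : ~~ odd d -> A ord0 \in unitmx)
    (nu : nat) (nuP : has_index A nu) :
  (nu <= d)%N.
Proof.
apply: index_le nuP.
by apply: kernel_lifts_psd_rev => i; apply: psd_complexify.
Qed.
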